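(* Let $S_5\subseteq(\mathbb C^2)^{\otimes3}$ (three parties, one qubit each) be the 5-dimensional span of $|000\rangle$, $|001\rangle-|100\rangle$, $|110\rangle-|011\rangle$, $|001\rangle+|010\rangle+|100\rangle$, $|110\rangle+|101\rangle+|011\rangle$. Then $S_5$ is locally indistinguishable: no orthonormal basis of $S_5$ is perfectly distinguishable by LOCC.
   Context: ''Perfectly distinguishable by LOCC'': there is a finite-round protocol, in each round one party performing a local measurement and broadcasting the outcome, that identifies with probability 1 which state of the set was given. *)

(* Defs.v *)
(* Scalars: an arbitrary numClosedFieldType C (the complex
   numbers are such a field). *)
From HB Require Import structures.
From mathcomp Require Import all_boot all_order all_algebra.
Set Implicit Arguments. Unset Strict Implicit. Unset Printing Implicit Defensive.
Import Order.TTheory GRing.Theory Num.Theory.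
Local Open Scope ring_scope.

(* A (unnormalised) vector of C^d0 (x) C^d1 (x) C^d2, as a 3-index tensor;
   index k belongs to party k. *)
Definition tensor (C : Type) (d0 d1 d2 : nat) :=
  'I_d0 -> 'I_d1 -> 'I_d2 -> C.

(* conjugate transpose *)
Definition adj (C : numClosedFieldType) m n (A : 'M[C]_(m, n)) : 'M[C]_(n, m) :=
  (map_mx (fun x => x^*) A)^T.

(* Finite LOCC protocol tree. At a node, one party applies a local quantum
   instrument given by Kraus operators K j (one per broadcast outcome j);
   the output local dimension m may differ from the input one (ancillas,
   discarding). At a leaf the protocol announces its guess. *)
Inductive locc (C : Type) : nat -> nat -> nat -> Type :=
| Guess (d0 d1 d2 : nat) (g : nat) : locc C d0 d1 d2
| Meas0 (d0 d1 d2 m n : nat) (K : 'I_n -> 'M[C]_(m, d0))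
    (next : 'I_n -> locc C m d1 d2) : locc C d0 d1 d2
| Meas1 (d0 d1 d2 m n : nat) (K : 'I_n -> 'M[C]_(m, d1))
    (next : 'I_n -> locc C d0 m d2) : locc C d0 d1 d2
| Meas2 (d0 d1 d2 m n : nat) (K : 'I_n -> 'M[C]_(m, d2))
    (next : 'I_n -> locc C d0 d1 m) : locc C d0 d1 d2.

(* validity: every instrument is trace preserving, sum_j K_j^dag K_j = 1 *)
Fixpoint valid (C : numClosedFieldType) d0 d1 d2 (P : locc C d0 d1 d2) : Prop :=
  match P with
  | Guess _ _ _ _ => True
  | Meas0 _ _ _ _ n K next =>
      \sum_(j < n) adj (K j) *m K j = 1%:M /\ forall j, valid (next j)
  | Meas1 _ _ _ _ n K next =>
      \sum_(j < n) adj (K j) *m K j = 1%:M /\ forall j, valid (next j)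
  | Meas2 _ _ _ _ n K next =>
      \sum_(j < n) adj (K j) *m K j = 1%:M /\ forall j, valid (next j)
  end.

Definition app0 (C : numClosedFieldType) d0 d1 d2 m (K : 'M[C]_(m, d0))
  (psi : tensor C d0 d1 d2) : tensor C m d1 d2 :=
  fun a b c => \sum_(a0 < d0) K a a0 * psi a0 b c.
Definition app1 (C : numClosedFieldType) d0 d1 d2 m (K : 'M[C]_(m, d1))
  (psi : tensor C d0 d1 d2) : tensor C d0 m d2 :=
  fun a b c => \sum_(b0 < d1) K b b0 * psi a b0 c.
Definition app2 (C : numClosedFieldType) d0 d1 d2 m (K : 'M[C]_(m, d2))
  (psi : tensor C d0 d1 d2) : tensor C d0 d1 m :=
  fun a b c => \sum_(c0 < d2) K c c0 * psi a b c0.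

(* [correct P psi i]: run on the (unnormalised) state psi, every leaf that is
   reached with nonzero probability (nonzero post-measurement vector) guesses
   i; i.e. P identifies i with probability 1. *)
Fixpoint correct (C : numClosedFieldType) d0 d1 d2 (P : locc C d0 d1 d2)
  : tensor C d0 d1 d2 -> nat -> Prop :=
  match P in locc _ e0 e1 e2 return tensor C e0 e1 e2 -> nat -> Prop with
  | Guess _ _ _ g => fun psi i => (forall a b c, psi a b c = 0) \/ g = i
  | Meas0 _ _ _ _ _ K next => fun psi i =>
      forall j, correct (next j) (app0 (K j) psi) i
  | Meas1 _ _ _ _ _ K next => fun psi i =>
      forall j, correct (next j) (app1 (K j) psi) i
  | Meas2 _ _ _ _ _ K next => fun psi i =>
      forall j, correct (next j) (app2 (K j) psi) i
  end.

(* A family of states is perfectly distinguishable by LOCC. *)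
Definition locc_perfectly_distinguishable (C : numClosedFieldType) d0 d1 d2 k
  (phi : 'I_k -> tensor C d0 d1 d2) : Prop :=
  exists P : locc C d0 d1 d2, valid P /\ forall i : 'I_k, correct P (phi i) i.

(* three-qubit computational basis vector |x y z> *)
Definition ket (C : numClosedFieldType) (x y z : nat) : tensor C 2 2 2 :=
  fun a b c => if [&& nat_of_ord a == x, nat_of_ord b == y & nat_of_ord c == z]
               then 1 else 0.

(* the five spanning vectors of S_5 *)
Definition gen5 (C : numClosedFieldType) (l : 'I_5) : tensor C 2 2 2 :=
  fun a b c =>
  match nat_of_ord l with
  | 0 => ket C 0 0 0 a b c
  | 1 => ket C 0 0 1 a b c - ket C 1 0 0 a b c
  | 2 => ket C 1 1 0 a b c - ket C 0 1 1 a b c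
  | 3 => ket C 0 0 1 a b c + ket C 0 1 0 a b c + ket C 1 0 0 a b c
  | _ => ket C 1 1 0 a b c + ket C 1 0 1 a b c + ket C 0 1 1 a b c
  end.

Definition inS5 (C : numClosedFieldType) (v : tensor C 2 2 2) : Prop :=
  exists w : 'I_5 -> C, forall a b c, v a b c = \sum_(l < 5) w l * gen5 C l a b c.

Definition inner (C : numClosedFieldType) d0 d1 d2 (u v : tensor C d0 d1 d2) : C :=
  \sum_(a < d0) \sum_(b < d1) \sum_(c < d2) (u a b c)^* * v a b c.

(* phi is an orthonormal basis of S_5: elements lie in S_5, are orthonormal,
   and span S_5. *)
Definition onb_S5 (C : numClosedFieldType) (phi : 'I_5 -> tensor C 2 2 2) : Prop :=
  [/\ forall i, inS5 (phi i),
      forall i j, inner (phi i) (phi j) = (i == j)%:R &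
      forall l, exists w : 'I_5 -> C,
        forall a b c, gen5 C l a b c = \sum_(i < 5) w i * phi i a b c].

(* Main.v *)
(* Pushing the Kraus operators of a protocol back to its root turns it into a
   separable measurement: product vectors x_l with sum_l |x_l><x_l| = 1, where
   x_l is orthogonal to every state that the protocol identifies with an index
   other than the guess of l.  No orthonormal basis phi of S_5 is perfectly
   distinguishable even by a separable measurement.  Indeed, whenever
   <x_l|phi_i> <> 0, the projection of x_l on S_5 is a multiple of phi_i.
   Suppose phi_i is not orthogonal to |001> - |100>.  The overlaps of a product
   vector with |001> - |100> and |110> - |011> are in the ratio of the two
   coordinates of its middle factor, so all these x_l, and hence also their
   combination phi_i, have middle slices in one and the same ratio.  Once this
   ratio is known, a vector is determined by its projection on S_5; hence phi_i
   is a multiple of x_l, a product vector.  But the product vectors of S_5 are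
   orthogonal to |001> - |100>.  So all phi_i are orthogonal to |001> - |100>,
   which lies in their span: a contradiction. *)
Require Import Defs.
From HB Require Import structures.
From mathcomp Require Import all_boot all_order all_algebra.
From mathcomp Require Import ring.
Set Implicit Arguments.
Unset Strict Implicit.
Unset Printing Implicit Defensive.
Import Order.TTheory GRing.Theory Num.Theory.
Local Open Scope ring_scope.

(* Pointwise, so as not to rely on functional extensionality. *)
Local Notation "x =3 y" := (forall a b c, x a b c = y a b c) (at level 70).

Definition lin_comb (C : numClosedFieldType) d0 d1 d2 (I : finType)
    (w : I -> C) (u : I -> tensor C d0 d1 d2) : tensor C d0 d1 d2 :=
  fun a b c => \sum_i w i * u i a b c.

Definition product_tensor (C : numClosedFieldType) d0 d1 d2
    (x : tensor C d0 d1 d2) : Prop :=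
  exists (u : 'I_d0 -> C) (v : 'I_d1 -> C) (w : 'I_d2 -> C),
    forall a b c, x a b c = u a * v b * w c.

Definition delta_tensor (C : numClosedFieldType) d0 d1 d2
    (p : 'I_d0 * 'I_d1 * 'I_d2) : tensor C d0 d1 d2 :=
  fun a b c => ((a, b, c) == p)%:R.

Section Tensors.
Variables (C : numClosedFieldType) (d0 d1 d2 : nat).
Implicit Types u v x t : tensor C d0 d1 d2.

Lemma inner_pairE u v :
  inner u v = \sum_p (u p.1.1 p.1.2 p.2)^* * v p.1.1 p.1.2 p.2.
Proof. by rewrite /inner !pair_bigA. Qed.

Lemma conj_inner u v : (inner u v)^* = inner v u.
Proof.
rewrite !inner_pairE rmorph_sum; apply: eq_bigr => p _.
by rewrite rmorphM /= conjCK mulrC.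
Qed.

Lemma inner_eq0C u v : (inner u v == 0) = (inner v u == 0).
Proof. by rewrite -conj_inner conjC_eq0. Qed.

Lemma inner_lin_combr (I : finType) (w : I -> C) (x : I -> tensor C d0 d1 d2)
    u v :
  v =3 lin_comb w x -> inner u v = \sum_i w i * inner u (x i).
Proof.
move=> vE; rewrite inner_pairE.
under eq_bigr do rewrite vE mulr_sumr.
rewrite exchange_big; apply: eq_bigr => i _; rewrite inner_pairE mulr_sumr.
by apply: eq_bigr => p _; rewrite mulrCA.
Qed.

Lemma inner_lin_combl (I : finType) (w : I -> C) (x : I -> tensor C d0 d1 d2)
    u v :
  v =3 lin_comb w x -> inner v u = \sum_i (w i)^* * inner (x i) u.
Proof.
move=> /inner_lin_combr vE; rewrite -conj_inner vE rmorph_sum.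
by apply: eq_bigr => i _; rewrite rmorphM /= conj_inner.
Qed.

Lemma inner_delta p u : inner (delta_tensor C p) u = u p.1.1 p.1.2 p.2.
Proof.
case: p => -[a b] c; rewrite inner_pairE (bigD1 (a, b, c)) //=.
rewrite /delta_tensor eqxx rmorph1 mul1r big1 ?addr0 // => -[[a' b'] c'] /negPf.
by move=> -> /=; rewrite rmorph0 mul0r.
Qed.

Lemma product_delta_tensor p : product_tensor (@delta_tensor C d0 d1 d2 p).
Proof.
exists (fun a => (a == p.1.1)%:R), (fun b => (b == p.1.2)%:R).
exists (fun c => (c == p.2)%:R) => a b c.
by case: p => -[a' b'] c'; rewrite -!natrM !mulnb.
Qed.

Lemma product_tensor_scale (k : C) x t :
  k != 0 -> (forall a b c, x a b c = t a b c * k) -> product_tensor x ->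
  product_tensor t.
Proof.
move=> k0 xE [u [v [w xuvw]]]; exists u, v, (fun c => w c / k) => a b c.
by apply: (mulIf k0); rewrite -xE xuvw -[RHS]mulrA divfK.
Qed.

Lemma inner_span_orthonormal (I : finType) (phi : I -> tensor C d0 d1 d2)
    (w : I -> C) i v x :
  (forall j k, inner (phi j) (phi k) = (j == k)%:R) -> v =3 lin_comb w phi ->
  (forall k, k != i -> inner (phi k) x = 0) ->
  inner v x = inner v (phi i) * inner (phi i) x.
Proof.
move=> orth vE x0; rewrite !(inner_lin_combl _ vE).
rewrite (bigD1 i) //= big1 => [|k /x0 ->]; last by rewrite mulr0.
rewrite [in RHS](bigD1 i) //= orth eqxx mulr1 big1 ?addr0 // => k /negPf ki.
by rewrite orth ki mulr0.
Qed.

End Tensors.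

Lemma sum_lin_comb (R : comPzSemiRingType) (J I : finType) (k : J -> R)
    (w : I -> R) (f : I -> J -> R) :
  \sum_p k p * (\sum_i w i * f i p) = \sum_i w i * \sum_p k p * f i p.
Proof.
under eq_bigr do rewrite mulr_sumr.
rewrite exchange_big; apply: eq_bigr => i _; rewrite mulr_sumr.
by apply: eq_bigr => p _; rewrite mulrCA.
Qed.

Lemma sum_mulmx1_apply (R : pzSemiRingType) (J : finType) m d
    (A : J -> 'M[R]_(d, m)) (B : J -> 'M[R]_(m, d)) (f : 'I_d -> R) a :
  \sum_j A j *m B j = 1%:M ->
  \sum_j \sum_p A j a p * (\sum_q B j p q * f q) = f a.
Proof.
move=> sumAB; pose F : 'cV[R]_d := \col_q f q.
transitivity ((\sum_j A j *m B j *m F) a 0).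
  rewrite summxE; apply: eq_bigr => j _; rewrite -mulmxA mxE.
  apply: eq_bigr => p _; rewrite [(_ *m F) _ _]mxE.
  by congr (_ * _); apply: eq_bigr => q _; rewrite mxE.
by rewrite -mulmx_suml sumAB mul1mx mxE.
Qed.

Section LocalOperators.
Variable C : numClosedFieldType.

Lemma sum_adj m d (K : 'M[C]_(m, d)) (f : 'I_m -> C) (g : 'I_d -> C) :
  \sum_a (\sum_p adj K a p * f p)^* * g a = \sum_p (f p)^* * \sum_a K p a * g a.
Proof.
under eq_bigr do rewrite rmorph_sum mulr_suml.
rewrite exchange_big; apply: eq_bigr => p _; rewrite mulr_sumr.
by apply: eq_bigr => a _; rewrite rmorphM !mxE /= conjCK mulrCA mulrA.
Qed.

Variables d0 d1 d2 m : nat.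

Lemma inner_app0 (K : 'M[C]_(m, d0)) (u : tensor C m d1 d2)
    (v : tensor C d0 d1 d2) :
  inner (app0 (adj K) u) v = inner u (app0 K v).
Proof.
rewrite /inner exchange_big [RHS]exchange_big; apply: eq_bigr => b _ /=.
rewrite exchange_big [RHS]exchange_big; apply: eq_bigr => c _ /=.
exact: sum_adj.
Qed.

Lemma inner_app1 (K : 'M[C]_(m, d1)) (u : tensor C d0 m d2)
    (v : tensor C d0 d1 d2) :
  inner (app1 (adj K) u) v = inner u (app1 K v).
Proof.
apply: eq_bigr => a _; rewrite exchange_big [RHS]exchange_big /=.
by apply: eq_bigr => c _; apply: sum_adj.
Qed.

Lemma inner_app2 (K : 'M[C]_(m, d2)) (u : tensor C d0 d1 m)
    (v : tensor C d0 d1 d2) :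
  inner (app2 (adj K) u) v = inner u (app2 K v).
Proof. by apply: eq_bigr => a _; apply: eq_bigr => b _; apply: sum_adj. Qed.

Variables (I : finType) (w : I -> C).

Lemma app0_lin_comb (K : 'M[C]_(m, d0)) (u : I -> tensor C d0 d1 d2) v :
  v =3 lin_comb w u -> app0 K v =3 lin_comb w (fun i => app0 K (u i)).
Proof.
move=> vE a b c; rewrite -[RHS]sum_lin_comb.
by apply: eq_bigr => p _; rewrite vE.
Qed.

Lemma app1_lin_comb (K : 'M[C]_(m, d1)) (u : I -> tensor C d0 d1 d2) v :
  v =3 lin_comb w u -> app1 K v =3 lin_comb w (fun i => app1 K (u i)).
Proof.
move=> vE a b c; rewrite -[RHS]sum_lin_comb.
by apply: eq_bigr => p _; rewrite vE.
Qed.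

Lemma app2_lin_comb (K : 'M[C]_(m, d2)) (u : I -> tensor C d0 d1 d2) v :
  v =3 lin_comb w u -> app2 K v =3 lin_comb w (fun i => app2 K (u i)).
Proof.
move=> vE a b c; rewrite -[RHS]sum_lin_comb.
by apply: eq_bigr => p _; rewrite vE.
Qed.

Lemma product_app0 (K : 'M[C]_(m, d0)) (x : tensor C d0 d1 d2) :
  product_tensor x -> product_tensor (app0 K x).
Proof.
case=> [u [v [s xE]]]; exists (fun a => \sum_p K a p * u p), v, s => a b c.
by rewrite !mulr_suml; apply: eq_bigr => p _; rewrite xE !mulrA.
Qed.

Lemma product_app1 (K : 'M[C]_(m, d1)) (x : tensor C d0 d1 d2) :
  product_tensor x -> product_tensor (app1 K x).
Proof.
case=> [u [v [s xE]]]; exists u, (fun b => \sum_p K b p * v p), s => a b c.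
rewrite mulr_sumr mulr_suml; apply: eq_bigr => p _.
by rewrite xE [u a * (_ * _)]mulrCA !mulrA.
Qed.

Lemma product_app2 (K : 'M[C]_(m, d2)) (x : tensor C d0 d1 d2) :
  product_tensor x -> product_tensor (app2 K x).
Proof.
case=> [u [v [s xE]]]; exists u, v, (fun c => \sum_p K c p * s p) => a b c.
by rewrite mulr_sumr; apply: eq_bigr => p _; rewrite xE mulrCA.
Qed.

End LocalOperators.

(* A measurement with rank-one elements |x_l><x_l|, each labelled by a guess. *)
Record measurement (C : numClosedFieldType) (d0 d1 d2 : nat) := Measurement {
  outcome : finType;
  guess : outcome -> nat;
  effect : outcome -> tensor C d0 d1 d2 }.
Arguments effect {C d0 d1 d2} m l.

Section Measurements.
Variable C : numClosedFieldType.

Section Properties.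
Variables (d0 d1 d2 : nat) (M : measurement C d0 d1 d2).

Definition separable : Prop := forall l, product_tensor (effect M l).

Definition complete : Prop :=
  forall psi, psi =3 lin_comb (fun l => inner (effect M l) psi) (effect M).

Definition identifies (psi : tensor C d0 d1 d2) (i : nat) : Prop :=
  forall l, guess l <> i -> inner (effect M l) psi = 0.

Lemma complete_detects psi :
  complete -> inner psi psi != 0 -> exists l, inner (effect M l) psi != 0.
Proof.
move=> completeM psi0; apply/existsP; apply: contraR psi0 => /existsPn overlap0.
rewrite (inner_lin_combr _ (completeM psi)) big1 // => l _.
by move/negPn/eqP: (overlap0 l) ->; rewrite mul0r.
Qed.

Lemma identifies_orthogonal k (phi : 'I_k -> tensor C d0 d1 d2) i j l :
  (forall i : 'I_k, identifies (phi i) i) ->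
  inner (effect M l) (phi i) != 0 -> j != i ->
  inner (phi j) (effect M l) = 0.
Proof.
move=> idM overlap; apply: contraNeq; rewrite inner_eq0C => overlap_j.
have guess_l p : inner (effect M l) (phi p) != 0 -> guess l = p.
  by move=> ov; apply/eqP; apply: contraNT ov => /eqP /idM ->.
by apply/eqP/val_inj; rewrite /= -!guess_l.
Qed.

End Properties.

Definition sep_perfectly_distinguishable d0 d1 d2 k
    (phi : 'I_k -> tensor C d0 d1 d2) : Prop :=
  exists M : measurement C d0 d1 d2,
    [/\ separable M, complete M & forall i : 'I_k, identifies M (phi i) i].

Definition basis_measurement d0 d1 d2 (g : nat) : measurement C d0 d1 d2 :=
  Measurement (fun=> g) (@delta_tensor C d0 d1 d2).

Lemma basis_measurement_complete d0 d1 d2 g :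
  complete (basis_measurement d0 d1 d2 g).
Proof.
move=> psi a b c; rewrite /lin_comb (bigD1 (a, b, c)) //= inner_delta.
rewrite /delta_tensor eqxx mulr1 big1 ?addr0 // => p /negPf.
by rewrite eq_sym => ->; rewrite mulr0.
Qed.

Section Pullback.
Variables (d0 d1 d2 e0 e1 e2 : nat) (J : finType).
Variable B : J -> tensor C e0 e1 e2 -> tensor C d0 d1 d2.
Variable M : J -> measurement C e0 e1 e2.

(* When B j is the adjoint of the j-th Kraus operator, this is the instrument
   followed by the measurement M j that depends on its outcome j. *)
Definition pullback : measurement C d0 d1 d2 :=
  @Measurement C d0 d1 d2 {j : J & outcome (M j)}
    (fun l => guess (tagged l))
    (fun l => B (tag l) (effect (M (tag l)) (tagged l))).

Lemma pullback_complete (A : J -> tensor C d0 d1 d2 -> tensor C e0 e1 e2) :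
  (forall j u v, inner (B j u) v = inner u (A j v)) ->
  (forall j (I : finType) (w : I -> C) u v,
     v =3 lin_comb w u -> B j v =3 lin_comb w (fun i => B j (u i))) ->
  (forall psi a b c, \sum_j B j (A j psi) a b c = psi a b c) ->
  (forall j, complete (M j)) -> complete pullback.
Proof.
move=> adjAB linB sumBA completeM psi a b c; rewrite -[LHS]sumBA.
under eq_bigr => j _ do rewrite (linB _ _ _ _ _ (completeM j (A j psi))).
rewrite /lin_comb sig_big_dep; apply: eq_bigr => l _ /=.
by rewrite adjAB.
Qed.

End Pullback.

Fixpoint locc_measurement d0 d1 d2 (P : locc C d0 d1 d2) :
    measurement C d0 d1 d2 :=
  match P with
  | Guess d0 d1 d2 g => basis_measurement d0 d1 d2 g
  | Meas0 _ _ _ _ _ K next =>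
      pullback (fun j => app0 (adj (K j))) (fun j => locc_measurement (next j))
  | Meas1 _ _ _ _ _ K next =>
      pullback (fun j => app1 (adj (K j))) (fun j => locc_measurement (next j))
  | Meas2 _ _ _ _ _ K next =>
      pullback (fun j => app2 (adj (K j))) (fun j => locc_measurement (next j))
  end.

Lemma locc_measurement_separable d0 d1 d2 (P : locc C d0 d1 d2) :
  separable (locc_measurement P).
Proof.
elim: P => {d0 d1 d2} [d0 d1 d2 g|d0 d1 d2 m n K next IH
  |d0 d1 d2 m n K next IH|d0 d1 d2 m n K next IH] /= l.
- exact: product_delta_tensor.
- exact/product_app0/IH.
- exact/product_app1/IH.
- exact/product_app2/IH.
Qed.

Lemma locc_measurement_complete d0 d1 d2 (P : locc C d0 d1 d2) :
  valid P -> complete (locc_measurement P).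
Proof.
elim: P => {d0 d1 d2} [d0 d1 d2 g|d0 d1 d2 m n K next IH
  |d0 d1 d2 m n K next IH|d0 d1 d2 m n K next IH] /=.
- by move=> _; apply: basis_measurement_complete.
- case=> sumK /(_ _)/IH; apply: (pullback_complete (A := fun j => app0 (K j))).
  + by move=> j u v; apply: inner_app0.
  + by move=> j I w u v; apply: app0_lin_comb.
  + by move=> psi a b c; apply: (sum_mulmx1_apply (fun q => psi q b c)).
- case=> sumK /(_ _)/IH; apply: (pullback_complete (A := fun j => app1 (K j))).
  + by move=> j u v; apply: inner_app1.
  + by move=> j I w u v; apply: app1_lin_comb.
  + by move=> psi a b c; apply: (sum_mulmx1_apply (fun q => psi a q c)).
- case=> sumK /(_ _)/IH; apply: (pullback_complete (A := fun j => app2 (K j))).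
  + by move=> j u v; apply: inner_app2.
  + by move=> j I w u v; apply: app2_lin_comb.
  + by move=> psi a b c; apply: (sum_mulmx1_apply (fun q => psi a b q)).
Qed.

Lemma locc_measurement_identifies d0 d1 d2 (P : locc C d0 d1 d2) psi i :
  correct P psi i -> identifies (locc_measurement P) psi i.
Proof.
elim: P psi => {d0 d1 d2} [d0 d1 d2 g|d0 d1 d2 m n K next IH
  |d0 d1 d2 m n K next IH|d0 d1 d2 m n K next IH] psi /=.
- by case=> [psi0|->] // p _; rewrite inner_delta.
- by move=> corr [j l] gl; rewrite /= inner_app0 IH.
- by move=> corr [j l] gl; rewrite /= inner_app1 IH.
- by move=> corr [j l] gl; rewrite /= inner_app2 IH.
Qed.

Lemma locc_sep_distinguishable d0 d1 d2 k (phi : 'I_k -> tensor C d0 d1 d2) :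
  locc_perfectly_distinguishable phi -> sep_perfectly_distinguishable phi.
Proof.
case=> P [validP corrP]; exists (locc_measurement P); split.
- exact: locc_measurement_separable.
- exact: locc_measurement_complete.
- by move=> i; apply: locc_measurement_identifies.
Qed.

End Measurements.

Lemma ord2_ind (P : 'I_2 -> Prop) : P ord0 -> P ord_max -> forall a, P a.
Proof.
move=> P0 P1 [[|[|//]] lt_a2].
- by rewrite (_ : Ordinal _ = ord0) //; apply: val_inj.
- by rewrite (_ : Ordinal _ = ord_max) //; apply: val_inj.
Qed.

Lemma big_ord2 (V : nmodType) (F : 'I_2 -> V) :
  \sum_a F a = F ord0 + F ord_max.
Proof. by rewrite big_ord_recl big_ord1; congr (_ + F _); apply: val_inj. Qed.

Section S5.
Variable C : numClosedFieldType.
Implicit Types (D E : C) (x t : tensor C 2 2 2) (phi : 'I_5 -> tensor C 2 2 2).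

Local Notation o0 := (ord0 : 'I_2).
Local Notation o1 := (ord_max : 'I_2).
Local Notation gen k := (gen5 C (@Ordinal 5 k isT)).

Lemma inner_gen5 t :
  [/\ inner (gen 0) t = t o0 o0 o0,
      inner (gen 1) t = t o0 o0 o1 - t o1 o0 o0,
      inner (gen 2) t = t o1 o1 o0 - t o0 o1 o1,
      inner (gen 3) t = t o0 o0 o1 + t o0 o1 o0 + t o1 o0 o0 &
      inner (gen 4) t = t o1 o1 o0 + t o1 o0 o1 + t o0 o1 o1].
Proof.
by split; rewrite /inner !big_ord2 /gen5 /ket /= ?(rmorphB, rmorphD) /=
  ?(rmorph0, rmorph1); ring.
Qed.

Lemma inS5_eqs t : inS5 t ->
  t o0 o0 o1 + t o1 o0 o0 = 2 * t o0 o1 o0 /\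
  t o1 o1 o0 + t o0 o1 o1 = 2 * t o1 o0 o1.
Proof.
by case=> w tE; split; rewrite !tE !big_ord_recl !big_ord0 /gen5 /ket /=; ring.
Qed.

(* The square of t001 - t100 is (t001 + t100)^2 - 4 t001 t100.  As t is a
   product, the linear equations of S_5 make the two terms equal. *)
Lemma product_inS5_gen1_eq0 t :
  inS5 t -> product_tensor t -> inner (gen 1) t = 0.
Proof.
move=> /inS5_eqs[t_one t_two] [u [v [w tE]]]; have [_ -> _ _ _] := inner_gen5 t.
have swap13 : t o0 o0 o1 * t o1 o0 o0 = t o0 o0 o0 * t o1 o0 o1.
  by rewrite !tE; ring.
have swap2 : t o0 o1 o0 * (t o0 o0 o1 + t o1 o0 o0) =
             t o0 o0 o0 * (t o1 o1 o0 + t o0 o1 o1).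
  by rewrite !tE; ring.
have sum_sqr : (t o0 o0 o1 + t o1 o0 o0) ^+ 2 =
               4 * (t o0 o0 o1 * t o1 o0 o0).
  by rewrite expr2 {1}t_one -mulrA swap2 t_two swap13; ring.
apply/eqP; rewrite -sqrf_eq0 -(subrr (4 * (t o0 o0 o1 * t o1 o0 o0))).
by rewrite -{1}sum_sqr; apply/eqP; ring.
Qed.

(* t_(a1c) : t_(a0c) = - E : D *)
Definition middle_ratio D E t : Prop :=
  forall a c, D * t a o1 c + E * t a o0 c = 0.

Lemma middle_ratio_product x :
  product_tensor x -> middle_ratio (inner (gen 1) x) (inner (gen 2) x) x.
Proof.
case=> u [v [w xE]] a c; have [_ -> -> _ _] := inner_gen5 x.
by rewrite !xE; ring.
Qed.

Lemma middle_ratio_scale (k D E : C) x :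
  k != 0 -> middle_ratio (D * k) (E * k) x -> middle_ratio D E x.
Proof.
move=> k0 ratio a c; apply: (mulfI k0).
by rewrite mulr0 -(ratio a c); ring.
Qed.

Lemma middle_ratio_lin_comb D E (I : finType) (w : I -> C)
    (x : I -> tensor C 2 2 2) t :
  t =3 lin_comb w x -> (forall i, w i != 0 -> middle_ratio D E (x i)) ->
  middle_ratio D E t.
Proof.
move=> tE ratio a c; rewrite !tE !mulr_sumr -big_split big1 //= => i _.
have [->|/ratio xi] := eqVneq (w i) 0; first by rewrite !mul0r !mulr0 addr0.
by rewrite !(mulrCA _ (w i)) -mulrDr xi mulr0.
Qed.

Lemma middle_ratio_proportional (k D E : C) x t :
  D != 0 -> middle_ratio D E x -> middle_ratio D E t ->
  (forall j, inner (gen5 C j) x = inner (gen5 C j) t * k) ->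
  forall a b c, x a b c = t a b c * k.
Proof.
move=> D0 ratio_x ratio_t proj.
have slice a c : x a o0 c = t a o0 c * k -> x a o1 c = t a o1 c * k.
  move=> x0; apply: (mulfI D0); apply: (addIr (E * x a o0 c)).
  by rewrite ratio_x x0 !mulrA -mulrDl ratio_t mul0r.
have [gx0 gx1 _ gx3 gx4] := inner_gen5 x.
have [gt0 gt1 _ gt3 gt4] := inner_gen5 t.
have x000 : x o0 o0 o0 = t o0 o0 o0 * k by rewrite -gx0 -gt0.
have x010 := slice _ _ x000.
have two_neq0 : 2 != 0 :> C by rewrite pnatr_eq0.
have x001 : x o0 o0 o1 = t o0 o0 o1 * k.
  apply: (mulfI two_neq0).
  transitivity (inner (gen 1) x + inner (gen 3) x - x o0 o1 o0).
    by rewrite gx1 gx3; ring.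
  by rewrite !proj gt1 gt3 x010; ring.
have x100 : x o1 o0 o0 = t o1 o0 o0 * k.
  transitivity (x o0 o0 o1 - inner (gen 1) x); first by rewrite gx1; ring.
  by rewrite proj gt1 x001; ring.
have [x011 x110] := (slice _ _ x001, slice _ _ x100).
have x101 : x o1 o0 o1 = t o1 o0 o1 * k.
  transitivity (inner (gen 4) x - x o1 o1 o0 - x o0 o1 o1).
    by rewrite gx4; ring.
  by rewrite proj gt4 x110 x011; ring.
have x_0_ a c : x a o0 c = t a o0 c * k.
  by elim/ord2_ind: a; elim/ord2_ind: c.
by move=> a b c; elim/ord2_ind: b => //; apply: slice.
Qed.

Lemma sep_onb_S5_gen1_eq0 (M : measurement C 2 2 2) phi i :
  onb_S5 phi -> separable M -> complete M ->
  (forall i : 'I_5, identifies M (phi i) i) -> inner (gen 1) (phi i) = 0.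
Proof.
case=> inS orth span sepM completeM idM; set t := phi i.
apply/eqP/negPn/negP => D0.
have proj l k : inner (effect M l) t != 0 ->
    inner (gen5 C k) (effect M l) = inner (gen5 C k) t * inner t (effect M l).
  move=> overlap; have [w genE] := span k.
  apply: (inner_span_orthonormal orth genE) => j.
  exact: identifies_orthogonal idM overlap.
have ratio_effect l : inner (effect M l) t != 0 ->
    middle_ratio (inner (gen 1) t) (inner (gen 2) t) (effect M l).
  move=> overlap; apply: (@middle_ratio_scale (inner t (effect M l))).
    by rewrite inner_eq0C.
  by rewrite -!proj //; apply: middle_ratio_product.
have ratio_t : middle_ratio (inner (gen 1) t) (inner (gen 2) t) t.
  exact: middle_ratio_lin_comb (completeM t) ratio_effect.
have [l overlap] : exists l, inner (effect M l) t != 0.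
  by apply: complete_detects completeM _; rewrite orth eqxx oner_eq0.
have effectE a b c : effect M l a b c = t a b c * inner t (effect M l).
  apply: (middle_ratio_proportional D0 (ratio_effect l overlap) ratio_t) => k.
  exact: proj.
have prod_t : product_tensor t.
  by apply: product_tensor_scale effectE (sepM l); rewrite inner_eq0C.
by rewrite (product_inS5_gen1_eq0 (inS i) prod_t) eqxx in D0.
Qed.

Lemma onb_S5_gen1_overlap phi :
  onb_S5 phi -> exists i, inner (gen 1) (phi i) != 0.
Proof.
case=> _ _ /(_ (@Ordinal 5 1 isT))[w genE]; apply/existsP.
apply: contraT => /existsPn overlap0.
have /eqP : inner (gen 1) (gen 1) = 0.
  rewrite (inner_lin_combr _ genE) big1 // => i _.
  by move/negPn/eqP: (overlap0 i) ->; rewrite mulr0.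
have [_ -> _ _ _] := inner_gen5 (gen 1).
by rewrite /gen5 /ket /= subr0 sub0r opprK -mulr2n pnatr_eq0.
Qed.

Lemma onb_S5_not_sep_distinguishable phi :
  onb_S5 phi -> ~ sep_perfectly_distinguishable phi.
Proof.
move=> onb [M [sepM completeM idM]]; have [i /eqP] := onb_S5_gen1_overlap onb.
by apply; apply: sep_onb_S5_gen1_eq0 idM.
Qed.

End S5.

Theorem theorem7 (C : numClosedFieldType) (phi : 'I_5 -> tensor C 2 2 2) :
  onb_S5 phi -> ~ locc_perfectly_distinguishable phi.
Proof.
by move=> onb /locc_sep_distinguishable; apply: onb_S5_not_sep_distinguishable.
Qed.
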